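(* For every integer $\ell\ge 2$ we have the $e$-positive expansion $$\mathcal{X}_P f_\ell=\mathcal{X}_P\sum_{i=3}^{\ell+1}(i-2)e_iz^i+2\bigl(E+\mathcal{X}_P\,G_{\ge \ell+2}\bigr)+\sum_{i=1}^{\ell-2}\bigl(E+\mathcal{X}_P\,G_{\ge \ell+2-i}\bigr)X_{P_i}z^i .$$ Hence the generating function $\sum_{n\ge \ell+1}X_{P_{n,\ell}}z^{n+1}$ is $e$-positive.
   Context: The chromatic symmetric function of a finite simple graph $H=(V,E)$ is $X_H=\sum_\kappa\prod_{u\in V}x_{\kappa(u)}$, the sum over all proper colorings $\kappa:V\to\mathbb{Z}_{>0}$. $P_n$ is the path with vertices $1,2,\dots,n$ in order ($X_{P_0}=1$). The twin of a graph at a vertex $v$ is obtained by adding a new vertex $v'$ joined to $v$ and to all neighbors of $v$; $P_{n,\ell}$ denotes $P_n$ twinned at the vertex $\ell$ (an interior vertex when $2\le\ell\le n-1$). $e_i$ is the $i$-th elementary symmetric function ($e_0=1$); a symmetric function is $e$-positive if its expansion in the elementary basis has nonnegative coefficients, and a power series in $z$ over symmetric functions is $e$-positive if each of its coefficients is. Notation: $E=E(z)=\sum_{i\ge 0}e_iz^i$, $\mathcal{X}_P=\mathcal{X}_P(z)=\sum_{n\ge 0}X_{P_n}z^n$, $G_{\ge k}=G_{\ge k}(z)=\sum_{i\ge k}(i-1)e_iz^i$, and for $\ell\ge 2$ $$f_\ell=f_\ell(z)=2+e_1z-X_{P_{\ell-1}}z^{\ell-1}(1-e_2z^2)-X_{P_\ell}z^\ell-X_{P_{\ell+1}}z^{\ell+1}.$$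 Empty sums are zero. *)

(* Defs.v *)
From HB Require Import structures.
From mathcomp Require Import all_boot all_order all_algebra.
From mathcomp Require Import finmap multiset.
From mathcomp Require Import boolp classical_sets cardinality.

Set Implicit Arguments.
Unset Strict Implicit.
Unset Printing Implicit Defensive.
Import GRing.Theory.

(* A commutative monoid in which every element has finitely many decompositions
   into two factors; fd_split m lists the pairs (a, b) with a + b = m.  This is
   what the Cauchy product of formal power series needs. *)
Record fdmonoid := FDMonoid {
  fd_sort :> eqType;
  fd_zero : fd_sort;
  fd_add : fd_sort -> fd_sort -> fd_sort;
  fd_addA : associative fd_add;
  fd_addC : commutative fd_add;
  fd_add0 : left_id fd_zero fd_add;
  fd_split : fd_sort -> seq (fd_sort * fd_sort);
  fd_split_uniq : forall m, uniq (fd_split m);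
  mem_fd_split : forall m p, (p \in fd_split m) = (fd_add p.1 p.2 == m)
}.

Lemma nat_split_uniq n : uniq [seq (i, n - i) | i <- iota 0 n.+1].
Proof. by rewrite map_inj_uniq ?iota_uniq // => i j []. Qed.

Lemma mem_nat_split n (p : nat * nat) :
  (p \in [seq (i, n - i) | i <- iota 0 n.+1]) = (p.1 + p.2 == n).
Proof.
case: p => a b; apply/mapP/eqP.
  by case=> i; rewrite mem_iota ltnS => le_in [-> ->]; rewrite /= subnKC.
move=> <-; exists a; last by rewrite addKn.
by rewrite mem_iota add0n ltnS /= leq_addr.
Qed.

Definition degree_fd : fdmonoid :=
  @FDMonoid nat 0 addn addnA addnC add0n _ nat_split_uniq mem_nat_split.

(* Monomials in countably many variables, as multisets of variable indices:
   the index i : nat stands for the variable x_(i+1). *)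
Definition mset_split (m : {mset nat}%mset) : seq ({mset nat}%mset * {mset nat}%mset) :=
  undup [seq (seq_mset (take k s), seq_mset (drop k s))
        | s <- permutations (enum_mset m), k <- iota 0 (size (enum_mset m)).+1].

Lemma mset_split_uniq m : uniq (mset_split m).
Proof. exact: undup_uniq. Qed.

Lemma seq_mset_cat (s t : seq nat) :
  seq_mset (s ++ t) = (seq_mset s `+` seq_mset t)%mset.
Proof. by apply/msetP => a; rewrite msetE2 !mset_seqE count_cat. Qed.

Lemma mem_mset_split m (p : {mset nat}%mset * {mset nat}%mset) :
  (p \in mset_split m) = (p.1 `+` p.2 == m)%mset.
Proof.
case: p => a b /=; rewrite mem_undup; apply/allpairsPdep/eqP.
  case=> s [k [+ _ [-> ->]]]; rewrite mem_permutations => sm.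
  by rewrite -seq_mset_cat cat_take_drop -[RHS]seq_mset_id; apply/eq_seq_msetP.
move=> abm; exists (enum_mset a ++ enum_mset b), (size (enum_mset a)).
have pm : perm_eq (enum_mset a ++ enum_mset b) (enum_mset m).
  by apply/eq_seq_msetP; rewrite seq_mset_cat !seq_mset_id.
split; first by rewrite mem_permutations.
  by rewrite mem_iota /= ltnS -(perm_size pm) size_cat leq_addr.
by rewrite take_size_cat // drop_size_cat // !seq_mset_id.
Qed.

Definition monomial_fd : fdmonoid :=
  @FDMonoid {mset nat}%mset mset0 (@msetD _) (@msetDA _) (@msetDC _) (@mset0D _)
    _ mset_split_uniq mem_mset_split.

Local Open Scope ring_scope.

(* Formal power series: arbitrary families of coefficients indexed by the
   exponents in M. *)
Record fps (M : fdmonoid) (R : comNzRingType) := Fps { coef : M -> R }.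
Arguments Fps {M R} coef.

HB.instance Definition _ M R := gen_eqMixin (fps M R).
HB.instance Definition _ M R := gen_choiceMixin (fps M R).

Section FpsRing.
Variables (M : fdmonoid) (R : comNzRingType).
Implicit Types f g h : fps M R.

Lemma fpsP f g : coef f =1 coef g -> f = g.
Proof. by case: f g => [f] [g] /= /funext ->. Qed.

Definition fps_zero : fps M R := Fps (fun=> 0).
Definition fps_opp f : fps M R := Fps (fun m => - coef f m).
Definition fps_add f g : fps M R := Fps (fun m => coef f m + coef g m).

Lemma fps_addA : associative fps_add.
Proof. by move=> f g h; apply: fpsP => m /=; rewrite addrA. Qed.
Lemma fps_addC : commutative fps_add.
Proof. by move=> f g; apply: fpsP => m /=; rewrite addrC. Qed.
Lemma fps_add0 : left_id fps_zero fps_add.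
Proof. by move=> f; apply: fpsP => m /=; rewrite add0r. Qed.
Lemma fps_addN : left_inverse fps_zero fps_opp fps_add.
Proof. by move=> f; apply: fpsP => m /=; rewrite addNr. Qed.

HB.instance Definition _ := GRing.isZmodule.Build (fps M R)
  fps_addA fps_addC fps_add0 fps_addN.

Definition fps_const (c : R) : fps M R :=
  Fps (fun m => if m == fd_zero M then c else 0).
Definition fps_mul f g : fps M R :=
  Fps (fun m => \sum_(p <- fd_split m) coef f p.1 * coef g p.2).

Lemma fps_mulC : commutative fps_mul.
Proof.
move=> f g; apply: fpsP => m /=.
have swapK : cancel (fun p : M * M => (p.2, p.1)) (fun p => (p.2, p.1)) by case.
rewrite (perm_big [seq (p.2, p.1) | p <- fd_split m]) /=; last first.
  apply: uniq_perm; rewrite ?(map_inj_uniq (can_inj swapK)) ?fd_split_uniq //.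
  move=> p; rewrite -[p in RHS]swapK mem_map; last exact: can_inj swapK.
  by rewrite !mem_fd_split /= fd_addC.
by rewrite big_map; apply: eq_bigr => p _; rewrite mulrC.
Qed.

Lemma fps_mulA : associative fps_mul.
Proof.
move=> f g h; apply: fpsP => m /=.
pose F (t : M * M * M) := coef f t.1.1 * coef g t.1.2 * coef h t.2.
pose L := [seq (p.1, q.1, q.2) | p <- fd_split m, q <- fd_split p.2].
pose L' := [seq (q.1, q.2, p.2) | p <- fd_split m, q <- fd_split p.1].
have -> : \sum_(p <- fd_split m) coef f p.1 *
            (\sum_(q <- fd_split p.2) coef g q.1 * coef h q.2) =
          \sum_(t <- L) F t.
  rewrite big_allpairs_dep /=; apply: eq_bigr => p _; rewrite mulr_sumr.
  by apply: eq_bigr => q _; rewrite /F mulrA.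
have -> : \sum_(p <- fd_split m)
            (\sum_(q <- fd_split p.1) coef f q.1 * coef g q.2) * coef h p.2 =
          \sum_(t <- L') F t.
  rewrite big_allpairs_dep /=; apply: eq_bigr => p _; rewrite mulr_suml.
  by apply: eq_bigr => q _.
apply: perm_big; apply: uniq_perm.
- apply: allpairs_uniq_dep => [|p _|]; rewrite ?fd_split_uniq //.
  move=> [p q] [p' q'] /allpairsPdep [p1 [q1 [_ q1p [-> ->]]]].
  move=> /allpairsPdep [p2 [q2 [_ q2p [-> ->]]]] /= [e1 e2 e3].
  move: q1p q2p; rewrite !mem_fd_split e2 e3 => /eqP e4 /eqP e5.
  have -> : p1 = p2 by rewrite [p1]surjective_pairing [p2]surjective_pairing
    e1 -e4 -e5.
  by rewrite [q1]surjective_pairing [q2]surjective_pairing e2 e3.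
- apply: allpairs_uniq_dep => [|p _|]; rewrite ?fd_split_uniq //.
  move=> [p q] [p' q'] /allpairsPdep [p1 [q1 [_ q1p [-> ->]]]].
  move=> /allpairsPdep [p2 [q2 [_ q2p [-> ->]]]] /= [e1 e2 e3].
  move: q1p q2p; rewrite !mem_fd_split e1 e2 => /eqP e4 /eqP e5.
  have -> : p1 = p2 by rewrite [p1]surjective_pairing [p2]surjective_pairing
    e3 -e4 -e5.
  by rewrite [q1]surjective_pairing [q2]surjective_pairing e1 e2.
move=> [[a b] c].
apply/allpairsPdep/allpairsPdep => [] [p [q []]]; rewrite !mem_fd_split.
  move=> /eqP pm /eqP qp [-> -> ->].
  exists (fd_add p.1 q.1, q.2), (p.1, q.1); split => //=.
    by rewrite mem_fd_split /= -fd_addA qp pm.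
  by rewrite mem_fd_split.
move=> /eqP pm /eqP qp [-> -> ->].
exists (q.1, fd_add q.2 p.2), (q.2, p.2); split => //=.
  by rewrite mem_fd_split /= fd_addA qp pm.
by rewrite mem_fd_split.
Qed.

Lemma fps_mul1 : left_id (fps_const 1) fps_mul.
Proof.
move=> f; apply: fpsP => m /=.
rewrite (bigD1_seq (fd_zero M, m)) ?fd_split_uniq ?mem_fd_split ?fd_add0 //=.
rewrite eqxx mul1r big_seq_cond big1 ?addr0 // => -[a b] /andP[].
rewrite mem_fd_split /=; have [->|_] := eqVneq a; last by rewrite mul0r.
by rewrite fd_add0 => /eqP ->; rewrite eqxx.
Qed.

Lemma fps_mulDl : left_distributive fps_mul +%R.
Proof.
move=> f g h; apply: fpsP => m /=; rewrite -big_split /=.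
by apply: eq_bigr => p _; rewrite mulrDl.
Qed.

Lemma fps_const1_neq0 : fps_const 1 != 0.
Proof.
apply/eqP => /(congr1 (fun f => coef f (fd_zero M))) /= /eqP.
by rewrite eqxx (negPf (oner_neq0 R)).
Qed.

HB.instance Definition _ := GRing.Zmodule_isComNzRing.Build (fps M R)
  fps_mulA fps_mulC fps_mul1 fps_mulDl fps_const1_neq0.

End FpsRing.

(* Z[[x_1, x_2, ...]], the ring in which symmetric functions live. *)
Notation xseries := (fps monomial_fd int).
(* Power series in z with coefficients in Z[[x_1, x_2, ...]]. *)
Notation zseries := (fps degree_fd xseries).

Definition zconst (c : xseries) : zseries := fps_const degree_fd c.
Definition zvar : zseries := Fps (fun k : degree_fd => (k == 1%N)%:R).

Record sgraph := SGraph {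
  vertex :> finType;
  adj : rel vertex;
  adj_sym : symmetric adj;
  adj_irr : irreflexive adj
}.

Definition proper_coloring (G : sgraph) (k : {ffun G -> nat}) : Prop :=
  forall u v : G, adj u v -> k u != k v.

(* The monomial prod_u x_(k u). *)
Definition coloring_monomial (G : sgraph) (k : {ffun G -> nat}) : {mset nat}%mset :=
  seq_mset [seq k u | u <- enum G].

Definition colorings_of (G : sgraph) (m : {mset nat}%mset) : set {ffun G -> nat} :=
  [set k | proper_coloring k /\ coloring_monomial k = m]%classic.
Arguments colorings_of : clear implicits.

(* fset_set is the empty set on infinite sets; this lemma rules that case out. *)
Lemma finite_colorings_of (G : sgraph) m : finite_set (colorings_of G m).
Proof.
pose b := (\max_(i <- enum_mset m) i).+1.
apply: (@sub_finite_set _ _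
  (range (fun k : {ffun G -> 'I_b} => [ffun u => nat_of_ord (k u)]))).
  move=> k [_ km].
  have kb u : (k u < b)%N.
    rewrite /b ltnS; apply: (@leq_bigmax_seq _ _ xpredT id) => //.
    rewrite -km (perm_mem (perm_eq_seq_mset _)).
    by apply: map_f; rewrite mem_enum.
  by exists [ffun u => Ordinal (kb u)] => //; apply/ffunP => u; rewrite !ffunE.
by apply: finite_image; apply: finite_finset.
Qed.

Definition chromatic (G : sgraph) : xseries :=
  Fps (fun m : monomial_fd => (#|` fset_set (colorings_of G m)|)%:R).

Definition path_adj n : rel 'I_n :=
  fun i j => (i.+1 == j :> nat) || (j.+1 == i :> nat).
Lemma path_adj_sym n : symmetric (@path_adj n).
Proof. by move=> i j; rewrite /path_adj orbC. Qed.
Lemma path_adj_irr n : irreflexive (@path_adj n).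
Proof. by move=> i; rewrite /path_adj orbb gtn_eqF. Qed.

(* The path vertices 1, ..., n are 0, ..., n.-1 here. *)
Definition path_graph n : sgraph := SGraph (@path_adj_sym n) (@path_adj_irr n).

(* None is the new vertex v'. *)
Definition twin_adj (G : sgraph) (v : G) : rel (option G) := fun a b =>
  match a, b with
  | Some u, Some w => adj u w
  | Some u, None | None, Some u => (u == v) || adj v u
  | None, None => false
  end.
Lemma twin_adj_sym (G : sgraph) (v : G) : symmetric (twin_adj v).
Proof. by move=> [a|] [b|] //=; apply: adj_sym. Qed.
Lemma twin_adj_irr (G : sgraph) (v : G) : irreflexive (twin_adj v).
Proof. by move=> [a|] //=; apply: adj_irr. Qed.

Definition twin (G : sgraph) (v : G) : sgraph :=
  SGraph (twin_adj_sym v) (twin_adj_irr v).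

Definition XP (n : nat) : xseries := chromatic (path_graph n).

(* Meaningful for 1 <= l <= n. *)
Definition XPtwin (n l : nat) : xseries :=
  if insub l.-1 is Some v then chromatic (@twin (path_graph n) v) else 0.

(* e_i is the sum of all squarefree monomials of degree i. *)
Definition elem (i : nat) : xseries :=
  Fps (fun m : monomial_fd =>
    (uniq (enum_mset m) && (size (enum_mset m) == i))%:R).

Definition is_partition (la : seq nat) : bool :=
  sorted geq la && (0%N \notin la).

Definition elem_part (la : seq nat) : xseries := \prod_(i <- la) elem i.

(* As the elem_part la, la a partition, form a basis, c is the expansion of F. *)
Definition e_positive (F : xseries) : Prop :=
  exists (ps : seq (seq nat)) (c : seq nat -> int),
    [/\ uniq ps, all is_partition ps, (forall la, la \in ps -> 0 <= c la)
      & F = \sum_(la <- ps) elem_part la *~ c la].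

Definition z_e_positive (F : zseries) : Prop := forall n : nat, e_positive (coef F n).

Definition Eser : zseries := Fps (elem : degree_fd -> xseries).

Definition XPser : zseries := Fps (XP : degree_fd -> xseries).

Definition Gser (k : nat) : zseries :=
  Fps (fun i : degree_fd => if (k <= i)%N then (i%:R - 1) * elem i else 0).

Definition fser (l : nat) : zseries :=
  2 + zconst (elem 1) * zvar
    - zconst (XP l.-1) * zvar ^+ l.-1 * (1 - zconst (elem 2) * zvar ^+ 2)
    - zconst (XP l) * zvar ^+ l
    - zconst (XP l.+1) * zvar ^+ l.+1.

(* sum_(n >= l + 1) X_(P_(n,l)) z^(n + 1) *)
Definition XPtwin_ser (l : nat) : zseries :=
  Fps (fun k : degree_fd => if (l.+2 <= k)%N then XPtwin k.-1 l else 0).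

(* Main.v *)
Require Import Defs.
From mathcomp Require Import all_boot all_order all_algebra.
From mathcomp Require Import finmap multiset.
From mathcomp Require Import boolp classical_sets cardinality.
From mathcomp Require Import zify ring.

(* All symmetric functions involved are sums of monomials of words.  A path
   coloring is a Smirnov word (no two equal adjacent letters) and e_i is the sum
   over strictly decreasing words of length i, so products become concatenations.

   Path recurrence.  Cut a word as D c S with D strictly decreasing and c S
   Smirnov.  If c is not in D, read it as a marked decreasing word (D, c) followed
   by S; if c is in D, move that letter c out of D as the mark.  This gives
   sum_(j < n) e_j X_(n-j) = sum_(1 <= i <= n) i e_i X_(n-i), that is,
   XP * (1 - G_2) = E.  Writing E + XP * G_k = XP * (1 - G_2 + G_k), the expansion
   of XP * f_l is an identity between the cofactors of XP, proved by induction on l.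

   Twins.  Deleting edges of the two triangles a v v' and v v' b of the twinned
   path (a coloring that violates two edges of a triangle violates the third)
   expresses P_(n,l) through products of paths, and the result is twice the
   coefficient of z^(n+1) in XP * f_l. *)

Set Implicit Arguments.
Unset Strict Implicit.
Unset Printing Implicit Defensive.
Import Order.TTheory GRing.Theory Num.Theory.

Local Open Scope ring_scope.

(** * Generating series of words *)

(** [permutations] lists each rearrangement once, so this is the sum, over all words satisfying [P],
    of the product of their letters read as variables. *)
Definition word_series (P : pred (seq nat)) : xseries :=
  Fps (fun m : monomial_fd => (count P (permutations (enum_mset m)))%:R).

Lemma eq_word_series P Q : P =1 Q -> word_series P = word_series Q.
Proof. by move=> eqPQ; apply: fpsP => m /=; rewrite (eq_count eqPQ). Qed.

(** The [perm_eq] conditions keep each word within its monomial, so [f] and [g] are inverse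
    bijections inside every coefficient. *)
Lemma word_series_bij (P Q : pred (seq nat)) (f g : seq nat -> seq nat) :
    (forall w, P w -> [/\ Q (f w), perm_eq (f w) w & g (f w) = w]) ->
    (forall w, Q w -> [/\ P (g w), perm_eq (g w) w & f (g w) = w]) ->
  word_series P = word_series Q.
Proof.
move=> PQ QP; apply: fpsP => m /=; congr (_%:R).
rewrite -!size_filter -(size_map f); apply: perm_size; apply: uniq_perm.
- rewrite map_inj_in_uniq ?filter_uniq ?permutations_uniq //.
  move=> u v; rewrite !mem_filter => /andP[/PQ[_ _ gu] _] /andP[/PQ[_ _ gv] _].
  by move=> /(congr1 g); rewrite gu gv.
- by rewrite filter_uniq ?permutations_uniq.
move=> w; rewrite mem_filter mem_permutations; apply/mapP/andP.
  case=> u; rewrite mem_filter mem_permutations => /andP[/PQ[Qf fu _] um] ->.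
  by split=> //; apply: perm_trans um.
case=> /QP[Pg gw fg] wm; exists (g w) => //.
by rewrite mem_filter Pg mem_permutations; apply: perm_trans wm.
Qed.

Lemma word_series_add (P Q R T : pred (seq nat)) :
    (forall w, (P w + Q w = R w + T w)%N) ->
  word_series P + word_series Q = word_series R + word_series T.
Proof.
move=> PQRT; apply: fpsP => m /=; rewrite -!natrD; congr (_%:R).
by elim: (permutations _) => //= w s IHs; rewrite addnACA PQRT IHs addnACA.
Qed.

Lemma word_series0 (P : pred (seq nat)) : (forall w, ~~ P w) -> word_series P = 0.
Proof.
move=> P0; apply: fpsP => m /=; rewrite (eq_count (a2 := pred0)) ?count_pred0 //.
by move=> w /=; apply/negbTE.
Qed.

(** The product is concatenation: fixing the length of the first factor makes the cut of a word
    unique, so nothing is counted twice. *)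
Lemma word_seriesM (P Q : pred (seq nat)) a : (forall w, P w -> size w = a) ->
  word_series P * word_series Q =
  word_series (fun w => P (take a w) && Q (drop a w)).
Proof.
move=> sizeP; apply: fpsP => m /=.
pose words p := [seq (u, v) | u <- filter P (permutations (enum_mset p.1)),
                              v <- filter Q (permutations (enum_mset p.2))].
pose L := [seq q.1 ++ q.2 | p <- mset_split m, q <- words p].
have wordsP p q :
    reflect [/\ P q.1, Q q.2, seq_mset q.1 = p.1 & seq_mset q.2 = p.2] (q \in words p).
  apply: (iffP allpairsP) => [[[u v] /= []]|].
    rewrite !mem_filter !mem_permutations => /andP[Pu up] /andP[Qv vp] -> /=.
    by rewrite -[p.1]seq_mset_id -[p.2]seq_mset_id; split=> //; apply/eq_seq_msetP.
  case=> Pq Qq q1 q2; exists q; split; last by case: (q).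
    rewrite mem_filter Pq mem_permutations -q1.
    by apply/eq_seq_msetP; rewrite seq_mset_id.
  rewrite mem_filter Qq mem_permutations -q2.
  by apply/eq_seq_msetP; rewrite seq_mset_id.
have words_uniq p : uniq (words p).
  by apply: allpairs_uniq; rewrite ?filter_uniq ?permutations_uniq //
    => -[? ?] [].
(* Grouping the concatenations by the split of [m] into the contents of the two factors reproduces
   the Cauchy product. *)
have perm_L : perm_eq L
    [seq w <- permutations (enum_mset m) | P (take a w) && Q (drop a w)].
  apply: uniq_perm.
  - apply: allpairs_uniq_dep => [|p _|]; rewrite ?mset_split_uniq //.
    move=> [p0 q0] [p0' q0'] /allpairsPdep[p [q [_ /wordsP[Pq _ q1 q2] [-> ->]]]].
    move=> /allpairsPdep[p' [q' [_ /wordsP[Pq' _ q'1 q'2] [-> ->]]]] /= /eqP.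
    rewrite eqseq_cat ?sizeP ?(sizeP q.1) ?(sizeP q'.1) // => /andP[/eqP e1 /eqP e2].
    have -> : p = p'.
      by rewrite [p]surjective_pairing [p']surjective_pairing -q1 -q2 e1 e2 q'1 q'2.
    by rewrite [q]surjective_pairing [q']surjective_pairing e1 e2.
  - by rewrite filter_uniq ?permutations_uniq.
  move=> w; rewrite mem_filter mem_permutations; apply/allpairsPdep/andP.
    case=> p [q [pm /wordsP[Pq Qq q1 q2] ->]].
    rewrite take_size_cat ?drop_size_cat ?sizeP // Pq Qq; split=> //.
    apply/eq_seq_msetP; rewrite seq_mset_cat q1 q2 seq_mset_id.
    by apply/eqP; rewrite -mem_mset_split.
  case=> /andP[Pt Qd] wm.
  exists (seq_mset (take a w), seq_mset (drop a w)), (take a w, drop a w).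
  rewrite cat_take_drop; split=> //; last exact/wordsP.
  rewrite mem_mset_split /= -seq_mset_cat cat_take_drop -[X in _ == X]seq_mset_id.
  exact/eqP/eq_seq_msetP.
rewrite -[X in _ = X%:R]size_filter -(perm_size perm_L) size_allpairs_dep.
rewrite sumnE big_map natr_sum.
by apply: eq_bigr => p _; rewrite size_allpairs !size_filter natrM.
Qed.

(** The list [r] fixes the order in which the vertices are read, which turns a coloring into a word;
    [phi] is the way back. *)
Lemma chromatic_word_series (G : sgraph) (r : seq G) (P : pred (seq nat)) :
    perm_eq r (enum G) -> (forall w, P w -> size w = size r) ->
    (forall k : {ffun G -> nat}, proper_coloring k <-> P [seq k u | u <- r]) ->
  chromatic G = word_series P.
Proof.
move=> rG sizeP properP; apply: fpsP => m /=; congr (_%:R).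
pose phi (w : seq nat) : {ffun G -> nat} := [ffun u => nth 0%N w (index u r)].
have uniq_r : uniq r by rewrite (perm_uniq rG) enum_uniq.
have mem_r u : u \in r by rewrite (perm_mem rG) mem_enum.
have phiK w : size w = size r -> [seq phi w u | u <- r] = w.
  move=> sw; apply: (@eq_from_nth _ 0%N); rewrite size_map // => i ir.
  have u0 : G by case: (r) ir.
  by rewrite (nth_map u0) // ffunE index_uniq.
rewrite -size_filter -(size_map phi); apply: perm_size.
apply: uniq_perm; first exact: fset_uniq.
  rewrite map_inj_in_uniq ?filter_uniq ?permutations_uniq //.
  move=> u v; rewrite !mem_filter => /andP[/sizeP su _] /andP[/sizeP sv _] e.
  by rewrite -(phiK u) // -(phiK v) // e.
move=> k; rewrite (in_fset_set (@finite_colorings_of G m)).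
apply/idP/mapP.
  rewrite inE => -[kP km]; exists [seq k u | u <- r].
    rewrite mem_filter mem_permutations (properP k).1 //=.
    apply/eq_seq_msetP; rewrite seq_mset_id -km; apply/eq_seq_msetP.
    exact: perm_map.
  apply/ffunP => u; rewrite ffunE (nth_map u) ?nth_index ?index_mem //.
case=> w; rewrite mem_filter mem_permutations => /andP[Pw wm] ->.
rewrite inE; split; first by apply/properP; rewrite phiK ?sizeP.
rewrite /coloring_monomial -[RHS]seq_mset_id; apply/eq_seq_msetP.
apply: perm_trans wm; rewrite -[X in perm_eq _ X](phiK w) ?sizeP //.
by apply: perm_map; rewrite perm_sym.
Qed.

(** * Paths and elementary symmetric functions as words *)

Definition smirnov (w : seq nat) : bool := sorted (fun x y => x != y) w.
Arguments smirnov w : simpl never.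

Lemma proper_path_coloring n (k : {ffun path_graph n -> nat}) :
  proper_coloring k <-> smirnov [seq k u | u <- enum 'I_n].
Proof.
have nthk (i : nat) (lt_in : (i < n)%N) :
    nth 0%N [seq k u | u <- enum 'I_n] i = k (Ordinal lt_in).
  rewrite (nth_map (Ordinal lt_in)) ?size_enum_ord //.
  by congr (k _); apply: val_inj; rewrite /= nth_enum_ord.
split=> [kP|/(sortedP 0%N) kP u v].
  apply/(sortedP 0%N) => i; rewrite size_map size_enum_ord => lt_in.
  by rewrite (nthk _ (ltnW lt_in)) (nthk _ lt_in) kP //= /path_adj eqxx.
have step (i j : 'I_n) : i.+1 = j :> nat -> k i != k j.
  move=> ij; have lt_in : (i.+1 < n)%N by rewrite ij.
  have := kP i; rewrite size_map size_enum_ord (nthk i (ltn_ord i)) (nthk _ lt_in).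
  move=> /(_ lt_in); congr (k _ != k _); exact: val_inj.
by case/orP => /eqP /step //; rewrite eq_sym.
Qed.

Lemma XP_word_series n :
  XP n = word_series (fun w => (size w == n) && smirnov w).
Proof.
apply: (@chromatic_word_series (path_graph n) (enum 'I_n)) => //.
  by move=> w /andP[/eqP-> _]; rewrite size_enum_ord.
by move=> k; rewrite size_map size_enum_ord eqxx; apply: proper_path_coloring.
Qed.

Lemma enum_mset_eq0 (m : {mset nat}%mset) : (size (enum_mset m) == 0%N) = (m == mset0).
Proof.
rewrite size_eq0; apply/eqP/eqP => [m0|->]; last exact: enum_mset0.
by rewrite -[m]seq_mset_id m0; apply/msetP => a; rewrite mset_seqE mset0E.
Qed.

Lemma elem0 : elem 0 = 1.
Proof.
apply: fpsP => m /=; rewrite enum_mset_eq0.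
by have [->|_] := eqVneq m; rewrite ?andbF // enum_mset0.
Qed.

Lemma XP0 : XP 0 = 1.
Proof.
rewrite XP_word_series; apply: fpsP => m /=.
rewrite -(enum_mset_eq0 m) size_eq0.
have [->|m0] := eqVneq (enum_mset m) [::] => //.
rewrite (eq_in_count (a2 := pred0)) ?count_pred0 // => w.
rewrite mem_permutations => /perm_size ->.
by rewrite size_eq0 (negPf m0).
Qed.

Lemma sort_geq_gtn (s : seq nat) : uniq s -> sorted gtn (sort geq s).
Proof.
by move=> us; rewrite gtn_sorted_uniq_geq sort_uniq us sort_sorted //.
Qed.

(** A multiset without repetitions has exactly one strictly decreasing arrangement; any other
    multiset has none. *)
Lemma elem_word_series i :
  elem i = word_series (fun w => (size w == i) && sorted gtn w).
Proof.
apply: fpsP => m /=; congr (_%:R).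
case: andP => [[um /eqP sm]|nm]; last first.
  rewrite (eq_in_count (a2 := pred0)) ?count_pred0 // => w /=.
  rewrite mem_permutations => wm; apply/negP => /andP[sw sorted_w]; apply: nm.
  rewrite -(perm_uniq wm) -(perm_size wm) sw; split=> //.
  by move: sorted_w; rewrite gtn_sorted_uniq_geq => /andP[].
have sortP := sort_geq_gtn um.
rewrite (eq_in_count (a2 := pred1 (sort geq (enum_mset m)))) => [|w /=].
  rewrite count_uniq_mem ?permutations_uniq // mem_permutations.
  by rewrite perm_sort perm_refl.
rewrite mem_permutations => wm; rewrite (perm_size wm) sm eqxx /=.
apply/idP/eqP => [sorted_w|->] //.
apply: (irr_sorted_eq _ _ sorted_w sortP) => [y x z|x|x] /=.
- by move=> xy yz; apply: ltn_trans yz xy.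
- exact: ltnn.
by rewrite mem_sort; apply: perm_mem.
Qed.

Lemma gtn_trans : transitive gtn.
Proof. by move=> y x z xy yz; apply: ltn_trans yz xy. Qed.

Lemma sorted_gtn_perm (s t : seq nat) :
  sorted gtn s -> perm_eq s t -> s = sort geq t.
Proof.
move=> ss st; have us : uniq s by move: ss; rewrite gtn_sorted_uniq_geq => /andP[].
have tt : sorted gtn (sort geq t) by rewrite sort_geq_gtn // -(perm_uniq st).
apply: (irr_sorted_eq gtn_trans ltnn ss tt) => x.
by rewrite mem_sort; apply: perm_mem.
Qed.

Lemma coef_natM n (F : xseries) m : coef (n%:R * F) m = n%:R * coef F m.
Proof.
elim: n => [|n IHn]; first by rewrite !mul0r.
by rewrite -!natr1 !mulrDl !mul1r -IHn.
Qed.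

(** These are decreasing words with a marked letter, the mark being written last. A set of [j.+1]
    letters has [j.+1] choices of mark, and the other letters can then be arranged in one way
    only. *)
Lemma natM_elem_word_series j :
  j.+1%:R * elem j.+1 = word_series (fun w =>
    [&& size w == j.+1, sorted gtn (take j w) & nth 0%N w j \notin take j w]).
Proof.
apply: fpsP => m; rewrite coef_natM /= -natrM; congr (_%:R).
set s := enum_mset m.
case: andP => [[us /eqP ss]|ns]; last first.
  rewrite muln0 (eq_in_count (a2 := pred0)) ?count_pred0 // => w /=.
  rewrite mem_permutations => ws; apply/negP => /and3P[/eqP sw st wt]; apply: ns.
  rewrite -(perm_uniq ws) -(perm_size ws) sw; split=> //.
  move: st; rewrite gtn_sorted_uniq_geq => /andP[ut _].
  by rewrite -[w]take_size sw (take_nth 0%N) ?sw // rcons_uniq wt.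
rewrite muln1 -size_filter -[LHS]ss.
rewrite -(size_map (fun c => rcons (sort geq (rem c s)) c)).
apply: perm_size; apply: uniq_perm.
- by rewrite map_inj_uniq // => x y /rcons_inj[].
- by rewrite filter_uniq ?permutations_uniq.
move=> w; rewrite mem_filter mem_permutations; apply/mapP/andP.
  case=> c cs ->; have sc : size (sort geq (rem c s)) = j.
    by rewrite size_sort size_rem // ss.
  rewrite /= size_rcons sc eqxx nth_rcons sc ltnn eqxx -cats1 take_size_cat //.
  rewrite sort_geq_gtn ?rem_uniq // mem_sort mem_rem_uniqF //; split=> //.
  rewrite cats1 perm_rcons perm_sym (permPl (perm_to_rem cs)) perm_cons perm_sym.
  by rewrite perm_sort.
case=> /and3P[/eqP]; case/lastP: w => // D c; rewrite size_rcons => -[sD].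
rewrite -cats1 take_size_cat // cats1 nth_rcons sD ltnn eqxx => gD cD Dcs.
have cs : c \in s by rewrite -(perm_mem Dcs) mem_rcons mem_head.
exists c => //; congr rcons; apply: sorted_gtn_perm => //.
by rewrite -(perm_cons c) -(permPr (perm_to_rem cs)) -perm_rcons.
Qed.

(** * The path recurrence *)

Lemma word_seriesD (P Q R : pred (seq nat)) :
    (forall w, P w = (Q w + R w)%N :> nat) ->
  word_series P = word_series Q + word_series R.
Proof.
move=> PQR; rewrite -[LHS]addr0 -(@word_series0 pred0) //.
by apply: word_series_add => w; rewrite addn0.
Qed.

(* Words D c S with D decreasing of length j and c S Smirnov, where the letter c
   is absent from D (cut_new) or occurs in D (cut_old). *)
Definition cut_new n j (w : seq nat) :=
  [&& (j < size w)%N, size w == n, sorted gtn (take j w), smirnov (drop j w)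
    & nth 0%N w j \notin take j w].

Definition cut_old n j (w : seq nat) :=
  [&& (j < size w)%N, size w == n, sorted gtn (take j w), smirnov (drop j w)
    & nth 0%N w j \in take j w].

Lemma elem_XP_cut n j : (j < n)%N ->
  elem j * XP (n - j) = word_series (cut_new n j) + word_series (cut_old n j).
Proof.
move=> jn; rewrite elem_word_series XP_word_series (@word_seriesM _ _ j); last first.
  by move=> w /andP[/eqP].
apply: word_seriesD => w; rewrite /cut_new /cut_old size_take_min size_drop.
case: (sorted _ _); rewrite /= ?andbF //.
case: (smirnov _); rewrite /= ?andbF // !andbT.
case: (_ \in _); rewrite /= ?andbT ?andbF; lia.
Qed.

(** Let [c] be the mark. If the Smirnov factor is empty or starts with another letter, prefixing [c]
    to it gives a word of [cut_new]. If it starts with [c], sorting the mark into the decreasing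
    part gives a word of [cut_old n j.+1]. *)
Lemma natM_elem_XP_cut n j : (j < n)%N ->
  j.+1%:R * elem j.+1 * XP (n - j.+1) =
  word_series (cut_new n j) + word_series (cut_old n j.+1).
Proof.
(* [rep] collects the words [D c c S], in which the letter after the mark repeats it. *)
move=> jn; pose rep w := [&& (j.+1 < size w)%N, size w == n, sorted gtn (take j w),
  smirnov (drop j.+1 w), nth 0%N w j \notin take j w & nth 0%N w j.+1 == nth 0%N w j].
rewrite natM_elem_word_series XP_word_series (@word_seriesM _ _ j.+1); last first.
  by move=> w /andP[/eqP].
rewrite (@word_seriesD _ (cut_new n j) rep) => [|w]; last first.
  rewrite /cut_new /rep size_take_min size_drop take_takel // nth_take //.
  have [wn|wn] := eqVneq (size w) n; last first.
    rewrite !andbF andbC; case: eqP => [?|]; rewrite ?andbF //.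
    by case: eqP => // ?; lia.
  rewrite wn jn (minn_idPl jn) !eqxx /= [drop j w](drop_nth 0%N) ?wn //.
  case: (sorted _ _); rewrite ?andbF //=.
  case: (_ \in _); rewrite ?andbF //= ?andbT.
  case: ltnP => jn1; last by rewrite /smirnov drop_oversize ?wn.
  rewrite [drop j.+1 w](drop_nth 0%N) ?wn // /smirnov /= eq_sym.
  by case: eqP => _; case: path.
congr (_ + _).
have repP w : rep w -> exists D c S, [/\ w = rcons D c ++ c :: S, size D = j,
    sorted gtn D, c \notin D & smirnov (c :: S)].
  case/and5P=> jw /eqP wn gw sw /andP[cw /eqP cc].
  exists (take j w), (nth 0%N w j), (drop j.+2 w).
  rewrite -take_nth ?(ltnW jw) // -{1 3}cc -drop_nth // cat_take_drop.
  by rewrite size_takel // ltnW // ltnW.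
have repI D c S : size D = j -> size (rcons D c ++ c :: S) = n -> sorted gtn D ->
    c \notin D -> smirnov (c :: S) -> rep (rcons D c ++ c :: S).
  move=> sD sn gD cD sS.
  rewrite /rep sn eqxx drop_size_cat ?size_rcons ?sD // sS.
  rewrite -cats1 -catA /= take_size_cat //.
  rewrite !nth_cat sD ltnn subnn (ltnNge j.+1 j) leqnSn subSnn /= gD cD eqxx.
  by move: sn; rewrite size_cat size_rcons sD /=; lia.
have oldP w : cut_old n j.+1 w -> exists D c S, [/\ w = D ++ c :: S, size D = j.+1,
    sorted gtn D, c \in D & smirnov (c :: S)].
  case/and5P=> jw /eqP wn gw sw cw.
  exists (take j.+1 w), (nth 0%N w j.+1), (drop j.+2 w).
  by rewrite -drop_nth // cat_take_drop size_takel // ltnW.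
have oldI D c S : size D = j.+1 -> size (D ++ c :: S) = n -> sorted gtn D ->
    c \in D -> smirnov (c :: S) -> cut_old n j.+1 (D ++ c :: S).
  move=> sD sn gD cD sS; rewrite /cut_old sn eqxx take_size_cat // drop_size_cat //.
  rewrite nth_cat sD ltnn subnn sS /= gD cD.
  by move: sn; rewrite size_cat sD /=; lia.
have uniq_gtn D : sorted gtn D -> uniq D by rewrite gtn_sorted_uniq_geq => /andP[].
(* [f] sorts the mark into the decreasing prefix; [g] recovers it as the letter of the prefix that
   equals the first letter after the prefix. *)
pose f (w : seq nat) := sort geq (take j.+1 w) ++ drop j.+1 w.
pose g (w : seq nat) := rcons (rem (nth 0%N w j.+1) (take j.+1 w)) (nth 0%N w j.+1)
                        ++ drop j.+1 w.
have fE D c S : size D = j -> f (rcons D c ++ c :: S) = sort geq (rcons D c) ++ c :: S.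
  by move=> sD; rewrite /f take_size_cat ?drop_size_cat // size_rcons sD.
have gE D c S : size D = j.+1 -> g (D ++ c :: S) = rcons (rem c D) c ++ c :: S.
  move=> sD; rewrite /g take_size_cat ?drop_size_cat //.
  by rewrite nth_cat sD ltnn subnn.
have size_cut w : rep w || cut_old n j.+1 w -> size w = n.
  by case/orP => /and3P[_ /eqP].
apply: (word_series_bij (f := f) (g := g)) => w Pw.
  have := size_cut w; rewrite Pw => /(_ isT) sw.
  have [D [c [S [wE sD gD cD sS]]]] := repP _ Pw.
  have pf : perm_eq (f w) w by rewrite wE fE // perm_cat2r perm_sort.
  have uDc : uniq (rcons D c) by rewrite rcons_uniq cD uniq_gtn.
  split=> //.
    rewrite wE fE //; apply: oldI;
      rewrite ?mem_sort ?mem_rcons ?mem_head ?sort_geq_gtn //.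
      by rewrite size_sort size_rcons sD.
    by rewrite -sw -(perm_size pf) wE fE.
  rewrite wE fE // gE; last by rewrite size_sort size_rcons sD.
  congr (rcons _ _ ++ _); rewrite [RHS](sorted_gtn_perm gD (perm_refl D)).
  apply: sorted_gtn_perm.
    apply: (subseq_sorted gtn_trans (rem_subseq _ _)); exact: sort_geq_gtn.
  rewrite -(perm_cons c) perm_sym.
  have cs : c \in sort geq (rcons D c) by rewrite mem_sort mem_rcons mem_head.
  by rewrite -(permPr (perm_to_rem cs)) perm_sym perm_sort perm_rcons.
have := size_cut w; rewrite Pw orbT => /(_ isT) sw.
have [D [c [S [wE sD gD cD sS]]]] := oldP _ Pw.
have srem : size (rem c D) = j by rewrite size_rem // sD.
have pg : perm_eq (g w) w.
  by rewrite wE gE // perm_cat2r perm_rcons perm_sym perm_to_rem.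
split=> //.
  rewrite wE gE //; apply: repI; rewrite ?mem_rem_uniqF ?uniq_gtn //.
    by rewrite -sw -(perm_size pg) wE gE.
  exact: (subseq_sorted gtn_trans (rem_subseq _ _)).
rewrite wE gE // fE //; congr (_ ++ _).
rewrite [RHS](sorted_gtn_perm gD (perm_refl D)).
have uD := uniq_gtn _ gD.
apply: sorted_gtn_perm.
  by rewrite sort_geq_gtn // rcons_uniq mem_rem_uniqF ?rem_uniq.
by rewrite perm_sort perm_rcons perm_sym perm_to_rem.
Qed.

(** Subtracting the two cut identities cancels [cut_new] and leaves [old j - old j.+1], which
    telescopes. *)
Lemma sum_elem_XP n :
  \sum_(i < n.+1) (1 - i%:R) * elem i * XP (n - i) = elem n.
Proof.
pose e i := elem i * XP (n - i); pose old j := word_series (cut_old n j).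
(* An empty prefix contains no letter, and a prefix of length [n] leaves no letter after it. *)
have [old0 oldn] : old 0%N = 0 /\ old n = 0.
  split; apply: word_series0 => w; rewrite /cut_old ?take0 ?in_nil ?andbF //.
  by apply/and3P => -[+ /eqP nw]; rewrite nw ltnn.
have step j : (j < n)%N -> e j - j.+1%:R * e j.+1 = old j - old j.+1.
  by move=> jn; rewrite /e mulrA natM_elem_XP_cut // elem_XP_cut // /old; ring.
(* The terms [i%:R * e i] are shifted by one index; the one for [i = 0] vanishes. *)
transitivity (e n + \sum_(j < n) (e j - j.+1%:R * e j.+1)); last first.
  rewrite {1}/e subnn XP0 mulr1 (eq_bigr (fun j : 'I_n => old j - old j.+1)).
    rewrite -(big_mkord xpredT (fun j => old j - old j.+1)).
    rewrite (telescope_sumr_eq (fun j => - old j)) //= ?old0 ?oldn.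
      by rewrite subrr addr0.
    by move=> k _; rewrite opprK addrC.
  by move=> j _; apply: step.
rewrite sumrB addrA [e n + _]addrC -(big_ord_recr n (fun i : 'I_n.+1 => e i)) /=.
transitivity (\sum_(i < n.+1) (e i - i%:R * e i)).
  by apply: eq_bigr => i _; rewrite /e; ring.
by rewrite sumrB [X in _ - X]big_ord_recl mul0r add0r.
Qed.

(** * Twinned paths *)

(** The twinned path is read as its left part [A], then v and v' with colors [x] and [y], then its
    right part [B]. *)
Definition splice a m (h : seq nat -> nat -> nat -> seq nat -> bool) (w : seq nat) :=
  if drop a w is x :: y :: B then (size B == m) && h (take a w) x y B else false.

Lemma spliceE a m h A x y B : size A = a -> size B = m ->
  splice a m h (A ++ x :: y :: B) = h A x y B.
Proof.
by move=> sA sB; rewrite /splice drop_size_cat // take_size_cat // sB eqxx.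
Qed.

Lemma spliceP a m h w : splice a m h w ->
  exists A x y B, [/\ w = A ++ x :: y :: B, size A = a, size B = m & h A x y B].
Proof.
rewrite /splice; case dw: (drop a w) => [|x [|y B]] // /andP[/eqP sB hw].
exists (take a w), x, y, B; rewrite -dw cat_take_drop; split=> //.
apply: size_takel; have := size_drop a w; rewrite dw /=; lia.
Qed.

Lemma word_series_splice a m h (P : pred (seq nat)) :
    (forall w, P w -> size w = (a + m).+2) ->
    (forall A x y B, size A = a -> size B = m -> P (A ++ x :: y :: B) = h A x y B) ->
  word_series P = word_series (splice a m h).
Proof.
move=> sizeP Ph; apply: eq_word_series => w; apply/idP/idP => [Pw|].
  have sw := sizeP w Pw; rewrite /splice.
  have st : size (take a w) = a by rewrite size_takel // sw; lia.
  have sd : size (drop a w) = m.+2 by rewrite size_drop sw; lia.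
  move: Pw; rewrite -{1}[w](cat_take_drop a).
  by case: (drop a w) sd => [|x [|y B]] //= [sB]; rewrite Ph // sB eqxx.
by case/spliceP=> A [x [y [B [-> sA sB hw]]]]; rewrite Ph.
Qed.

(* The flags p, q, r, s, t select which of the edges av, av', vv', vb, v'b of the
   twinned path are present, where a and b are the neighbours of v in the path. *)
Definition twin_word (p q r s t : bool) (A : seq nat) x y (B : seq nat) :=
  [&& smirnov A, smirnov B, p ==> (last 0%N A != x), q ==> (last 0%N A != y),
      r ==> (x != y), s ==> (x != head 0%N B) & t ==> (y != head 0%N B)].

Definition twin_words a m p q r s t := word_series (splice a m (twin_word p q r s t)).

(** Exchanging v and v' exchanges the letters [x] and [y] and leaves the monomial unchanged. *)
Lemma twin_words_swap a m p q r s t :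
  twin_words a m p q r s t = twin_words a m q p r t s.
Proof.
pose f (w : seq nat) :=
  if drop a w is x :: y :: B then take a w ++ y :: x :: B else w.
have fE A x y B : size A = a -> f (A ++ x :: y :: B) = A ++ y :: x :: B.
  by move=> sA; rewrite /f drop_size_cat // take_size_cat.
have fP p' q' r' s' t' w : splice a m (twin_word p' q' r' s' t') w ->
    [/\ splice a m (twin_word q' p' r' t' s') (f w), perm_eq (f w) w & f (f w) = w].
  case/spliceP=> A [x [y [B [-> sA sB /and5P[sm sm' hp hq /and3P[hr hs ht]]]]]].
  rewrite fE // fE // spliceE // perm_cat2l (perm_catCA [:: y] [:: x] B) perm_refl.
  by rewrite /twin_word sm sm' hp hq hs ht eq_sym hr.
by apply: (word_series_bij (f := f) (g := f)) => w /fP.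
Qed.

(** Both words are nonempty so that [last] and [head] return actual letters and not the default
    0. *)
Lemma smirnov_cat A B : (0 < size A)%N -> (0 < size B)%N ->
  smirnov (A ++ B) = [&& smirnov A, smirnov B & last 0%N A != head 0%N B].
Proof.
case: B => // b B; case/lastP: A => // A a _ _; rewrite last_rcons.
rewrite /smirnov sorted_cat_cons /=; case: A => [|c A] /=; first by rewrite andbT andbC.
by rewrite !rcons_path last_rcons -!andbA; do !bool_congr.
Qed.

(** Triangle a v v': since [x != y], the last letter of [A] equals at most one of [x] and [y]. The
    two violations exclude each other, so inclusion-exclusion has no further term. *)
Lemma twin_words_delete_a a m :
  twin_words a m true true true true true + twin_words a m false false true true true =
  twin_words a m true false true true true + twin_words a m false true true true true.
Proof.
apply: word_series_add => w; rewrite /splice.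
case: (drop a w) => [|x [|y B]] //.
case: eqP => //= _; rewrite /twin_word /=.
case: (smirnov _) => //; case: (smirnov _) => //=.
have [->|xy] /= := eqVneq x y; first by rewrite !andbF.
have [->|ax] := eqVneq (last 0%N (take a w)) x; rewrite /= ?xy ?addn0 ?add0n //.
by rewrite addnC.
Qed.

(** The same principle for the triangle v v' b, with the edge av' already removed. *)
Lemma twin_words_delete_b a m p :
  twin_words a m p false true true true + twin_words a m p false true false false =
  twin_words a m p false true false true + twin_words a m p false true true false.
Proof.
apply: word_series_add => w; rewrite /splice.
case: (drop a w) => [|x [|y B]] //.
case: eqP => //= _; rewrite /twin_word /=.
case: (smirnov _) => //; case: (smirnov _) => //=.
case: (p ==> _) => //=.
have [->|xy] /= := eqVneq x y; first by [].
have [yb|yb] := eqVneq y (head 0%N B); first by rewrite -yb xy.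
by rewrite andbT addnC.
Qed.

(** Deleting vv' adds the colorings with [x = y], for which the edges vb and v'b impose the same
    condition. *)
Lemma twin_words_move a m p :
  twin_words a m p false true true false + twin_words a m p false false false true =
  twin_words a m p false false true false + twin_words a m p false true false true.
Proof.
apply: word_series_add => w; rewrite /splice.
case: (drop a w) => [|x [|y B]] //.
case: eqP => //= _; rewrite /twin_word /=.
case: (smirnov _) => //; case: (smirnov _) => //=.
case: (p ==> _) => //=.
have [->|xy] /= := eqVneq x y; first by rewrite addn0 add0n !andbT.
by rewrite !andbT.
Qed.

(** * Evaluation of the reduced graphs by paths *)

Lemma smirnov_cons x B : (0 < size B)%N ->
  smirnov (x :: B) = (x != head 0%N B) && smirnov B.
Proof. by case: B. Qed.

Lemma smirnov_rcons A x : (0 < size A)%N ->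
  smirnov (rcons A x) = smirnov A && (last 0%N A != x).
Proof. by move=> sA; rewrite -cats1 smirnov_cat. Qed.

Lemma XPM_word_series i j : XP i * XP j = word_series (fun w =>
  [&& size w == (i + j)%N, smirnov (take i w) & smirnov (drop i w)]).
Proof.
rewrite !XP_word_series (@word_seriesM _ _ i) => [|w /andP[/eqP] //].
apply: eq_word_series => w; rewrite size_take_min size_drop.
case: (smirnov _); rewrite ?andbF //=; case: (smirnov _); rewrite ?andbF // !andbT; lia.
Qed.

(** The remaining edges av, vv', v'b form one path in word order. The reduced graphs evaluated next
    are disjoint unions of paths in the same way. *)
Lemma twin_words_path a m (a_gt0 : (0 < a)%N)
    (m_gt0 : (0 < m)%N) :
  twin_words a m true false true false true = XP (a + m).+2.
Proof.
rewrite XP_word_series; apply/esym/word_series_splice => [w /andP[/eqP] //|].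
move=> A x y B sA sB; rewrite size_cat /= sA sB !addnS eqxx /twin_word /=.
rewrite smirnov_cat ?sA //= !smirnov_cons //= ?sB //.
by lia.
Qed.

Lemma twin_words_cut_a a m (m_gt0 : (0 < m)%N) :
  twin_words a m false false true false true = XP a * XP m.+2.
Proof.
rewrite XPM_word_series; apply/esym/word_series_splice => [w /andP[/eqP->] _|].
  by rewrite !addnS.
move=> A x y B sA sB; rewrite size_cat /= sA sB eqxx /twin_word /=.
rewrite take_size_cat // drop_size_cat // !smirnov_cons //= ?sB //.
by lia.
Qed.

Lemma twin_words_cut_ab a m :
  twin_words a m false false true false false = XP a * (XP 2 * XP m).
Proof.
rewrite XPM_word_series XP_word_series (@word_seriesM _ _ a) => [|w /andP[/eqP] //].
apply/esym/word_series_splice => [w /andP[/andP[/eqP + _] /and3P[/eqP + _ _]]|].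
  by rewrite size_take_min size_drop; lia.
move=> A x y B sA sB; rewrite take_size_cat // drop_size_cat //= sA sB !eqxx /=.
rewrite take0 drop0 /twin_word /smirnov /= !andbT.
by lia.
Qed.

Lemma twin_words_cut_b a m (a_gt0 : (0 < a)%N) :
  twin_words a m true false true false false = XP a.+2 * XP m.
Proof.
rewrite XPM_word_series; apply/esym/word_series_splice => [w /andP[/eqP->] _|].
  by rewrite !addSn.
move=> A x y B sA sB; rewrite -!cat_rcons.
rewrite take_size_cat ?drop_size_cat ?size_rcons ?sA //.
rewrite size_cat !size_rcons sA sB eqxx /= !smirnov_rcons ?size_rcons ?sA //.
rewrite last_rcons /twin_word /=.
by lia.
Qed.

Lemma twin_words_cut_vv a m (a_gt0 : (0 < a)%N)
    (m_gt0 : (0 < m)%N) :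
  twin_words a m true false false false true = XP a.+1 * XP m.+1.
Proof.
rewrite XPM_word_series; apply/esym/word_series_splice => [w /andP[/eqP->] _|].
  by rewrite addSn addnS.
move=> A x y B sA sB; rewrite -cat_rcons.
rewrite take_size_cat ?drop_size_cat ?size_rcons ?sA //.
rewrite size_cat /= size_rcons sA sB eqxx /= smirnov_rcons ?sA //.
rewrite smirnov_cons ?sB // /twin_word /=.
by lia.
Qed.

(** The isolated vertex v' is read between v and b, so its letter is first moved to the front. *)
Lemma twin_words_isolated a m (a_gt0 : (0 < a)%N)
    (m_gt0 : (0 < m)%N) :
  twin_words a m true false false true false = XP 1 * XP (a + m).+1.
Proof.
pose f (w : seq nat) :=
  if drop a w is x :: y :: B then y :: take a w ++ x :: B else w.
pose g (w : seq nat) :=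
  if w is y :: w' then
    if drop a w' is x :: B then take a w' ++ x :: y :: B else w
  else w.
have fE A x y B : size A = a -> f (A ++ x :: y :: B) = y :: A ++ x :: B.
  by move=> sA; rewrite /f drop_size_cat // take_size_cat.
have gE A x y B : size A = a -> g (y :: A ++ x :: B) = A ++ x :: y :: B.
  by move=> sA; rewrite /g drop_size_cat // take_size_cat.
have perm_move (A : seq nat) x y B : perm_eq (y :: A ++ x :: B) (A ++ x :: y :: B).
  by rewrite -(cat1s y) perm_catCA perm_cat2l (perm_catCA [:: y] [:: x] B).
rewrite XPM_word_series; apply: (word_series_bij (f := f) (g := g)) => w.
  case/spliceP=> A [x [y [B [-> sA sB hw]]]]; rewrite fE // gE //; split=> //.
  rewrite /= take0 drop0 size_cat /= sA sB addnS add1n eqxx /=.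
  rewrite smirnov_cat ?sA //= smirnov_cons ?sB //.
  by move: hw; rewrite /twin_word /=; lia.
case/and3P=> /eqP; case: w => [|y w] // [sw] _ sm; rewrite /= drop0 in sm.
have [A [x [B [wE st sB]]]] :
    exists A x B, [/\ w = A ++ x :: B, size A = a & size B = m].
  exists (take a w), (nth 0%N w a), (drop a.+1 w).
  by rewrite -drop_nth ?cat_take_drop ?size_takel ?size_drop ?sw; do ?split=> //; lia.
rewrite {}wE in sm *.
rewrite gE // fE // perm_sym perm_move spliceE //; split=> //.
move: sm; rewrite smirnov_cat ?st //= smirnov_cons ?sB // /twin_word.
by rewrite /=; lia.
Qed.

(** Deletion at a leaves graphs with one edge or no edge at a; deletion at b reduces these to unions
    of paths, except for the path with v' pendant at v, which [twin_words_move] resolves. *)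
Lemma twin_words_full a m (a_gt0 : (0 < a)%N)
    (m_gt0 : (0 < m)%N) :
  twin_words a m true true true true true =
  2 * (2 * XP (a + m).+2 + XP 1 * XP (a + m).+1 - XP a.+1 * XP m.+1 - XP a.+2 * XP m)
  - XP a * (2 * XP m.+2 - XP 2 * XP m).
Proof.
have twin_ab := twin_words_delete_a a m.
have vb := twin_words_delete_b a m true.
have avb := twin_words_delete_b a m false.
have pend := twin_words_move a m true.
(* The swaps identify graphs that differ only in which of v and v' keeps its edge. *)
rewrite (twin_words_swap a m false true) in twin_ab.
rewrite (twin_words_swap a m false false true true false) in avb.
rewrite twin_words_cut_a // twin_words_cut_ab in avb.
rewrite twin_words_path // twin_words_cut_b // in vb.
rewrite twin_words_path // twin_words_cut_vv // twin_words_isolated // in pend.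
rewrite -[LHS](addrK (twin_words a m false false true true true)) twin_ab.
rewrite -[twin_words a m false _ _ _ _](addrK (XP a * (XP 2 * XP m))) avb.
rewrite -[twin_words a m true _ _ _ _](addrK (XP a.+2 * XP m)) vb.
rewrite -[twin_words a m true _ _ _ _](addrK (XP a.+1 * XP m.+1)) pend.
ring.
Qed.

(** Every edge of the twin other than vv' lies on one of the two paths obtained by omitting v' or v.
    The index [v] starts at 0, so it counts the vertices before the twinned one. *)
Lemma chromatic_twin_path n (v : path_graph n) :
  chromatic (twin v) =
  word_series (splice v (n - v.+1)%N (fun A x y B =>
    [&& smirnov (A ++ x :: B), smirnov (A ++ y :: B) & x != y])).
Proof.
set e := enum 'I_n; have se : size e = n := size_enum_ord n.
have ve : e = take v e ++ v :: drop v.+1 e.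
  rewrite -[LHS](cat_take_drop v) (drop_nth v) ?se ?ltn_ord //.
  by congr (_ ++ _ :: _); apply: val_inj; rewrite /= nth_enum_ord.
have st : size (take v e) = v by rewrite size_takel // se ltnW.
have sd : size (drop v.+1 e) = (n - v.+1)%N by rewrite size_drop se.
pose r : seq (twin v) := [seq Some u | u <- take v e] ++
  Some v :: None :: [seq Some u | u <- drop v.+1 e].
have uv : uniq e by apply: enum_uniq.
have [vt vd] : v \notin take v e /\ v \notin drop v.+1 e.
  by move: uv; rewrite {1}ve cat_uniq /= => /and4P[_ /norP[-> _] -> _].
apply: (@chromatic_word_series _ r).
- have re : perm_eq r (None :: [seq Some u | u <- e]).
    rewrite [in X in perm_eq _ X]ve map_cat /= perm_sym -(cat1s None) perm_catCA.
    by rewrite perm_cat2l (perm_catCA [:: None] [:: Some v]).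
  apply: perm_trans re _; apply: uniq_perm; rewrite ?enum_uniq //.
    rewrite /= map_inj_uniq ?uv ?andbT => [|u u' [] //].
    by apply/mapP => -[].
  move=> [u|]; rewrite mem_enum inE //=.
  by rewrite mem_map ?mem_enum // => u1 u2 [].
- move=> w /spliceP[A [x [y [B [-> sA sB _]]]]].
  by rewrite /r !size_cat /= !size_map sA sB st sd.
(* [k1] colors the path through v, [k2] the path through v'. *)
move=> k; pose k1 : {ffun path_graph n -> nat} := [ffun u => k (Some u)].
pose k2 : {ffun path_graph n -> nat} :=
  [ffun u => if u == v then k None else k (Some u)].
rewrite /r map_cat /= -!map_comp spliceE ?size_map //.
have -> : [seq (k \o Some) i | i <- take v e] ++
    k (Some v) :: [seq (k \o Some) i | i <- drop v.+1 e] = [seq k1 u | u <- e].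
  rewrite [in RHS]ve map_cat /=; congr (_ ++ _ :: _); rewrite ?ffunE //.
    by apply: eq_map => u /=; rewrite ffunE.
  by apply: eq_map => u /=; rewrite ffunE.
have -> : [seq (k \o Some) i | i <- take v e] ++
    k None :: [seq (k \o Some) i | i <- drop v.+1 e] = [seq k2 u | u <- e].
  rewrite [in RHS]ve map_cat /=; congr (_ ++ _ :: _); rewrite ?ffunE ?eqxx //.
    apply/eq_in_map => u ut /=; rewrite ffunE; case: eqP => // uv'.
    by move: ut; rewrite uv' (negPf vt).
  apply/eq_in_map => u ut /=; rewrite ffunE; case: eqP => // uv'.
  by move: ut; rewrite uv' (negPf vd).
split.
  move=> kP; apply/and3P; split; last by apply: kP; rewrite /= eqxx.
    by apply/proper_path_coloring => u u' uu'; rewrite !ffunE; apply: kP.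
  apply/proper_path_coloring => u u' uu'; rewrite !ffunE.
  have [uE|_] := eqVneq u v; have [u'E|_] := eqVneq u' v.
  + by move: uu'; rewrite uE u'E adj_irr.
  + by apply: kP; apply/orP; right; rewrite -uE.
  + by apply: kP; apply/orP; right; rewrite -u'E adj_sym.
  by apply: kP.
case/and3P=> /proper_path_coloring k1P /proper_path_coloring k2P kv.
have kN u : (u == v) || adj v u -> k (Some u) != k None.
  have [-> //|uv' /= vu] := eqVneq u v.
  by have := k2P _ _ vu; rewrite !ffunE eqxx (negPf uv') eq_sym.
move=> [u|] [u'|] //= uu'.
- by have := k1P _ _ uu'; rewrite !ffunE.
- exact: kN.
by rewrite eq_sym; apply: kN.
Qed.

(** Here [a] vertices precede the twinned one and [m] follow it; both numbers are positive because
    the vertex is interior. *)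
Lemma XPtwin_formula a m : (0 < a)%N -> (0 < m)%N ->
  XPtwin (a + m).+1 a.+1 =
  2 * (2 * XP (a + m).+2 + XP 1 * XP (a + m).+1 - XP a.+1 * XP m.+1 - XP a.+2 * XP m)
  - XP a * (2 * XP m.+2 - XP 2 * XP m).
Proof.
move=> a_gt0 m_gt0; rewrite -twin_words_full // /XPtwin /=.
have am : (a < (a + m).+1)%N by rewrite ltnS leq_addr.
rewrite insubT chromatic_twin_path /=.
have -> : ((a + m).+1 - a.+1 = m)%N by lia.
apply: word_series_splice => [w /spliceP[A [x [y [B [-> sA sB _]]]]]|A x y B sA sB].
  by rewrite size_cat /= sA sB !addnS.
rewrite spliceE // /twin_word /= !smirnov_cat ?sA //= !smirnov_cons ?sB //.
by lia.
Qed.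

(** * e-positivity *)

Lemma e_positiveP F :
  e_positive F <-> exists s, F = \sum_(la <- s) elem_part la.
Proof.
split=> [[ps [c [_ _ c_ge0 ->]]]|[s ->]].
  exists (flatten [seq nseq `|c la|%N la | la <- ps]).
  rewrite big_flatten big_map big_seq [RHS]big_seq; apply: eq_bigr => la /c_ge0 cla.
  by rewrite big_nseq iter_addr_0 -{1}(gez0_abs cla).
pose norm la := sort geq [seq i <- la | i != 0%N].
have normE la : elem_part (norm la) = elem_part la.
  rewrite /elem_part (perm_big [seq i <- la | i != 0%N]) ?perm_sort //= big_filter.
  rewrite [RHS](bigID (fun i => i != 0%N)) /= [X in _ * X]big1 ?mulr1 // => i.
  by rewrite negbK => /eqP ->; apply: elem0.
exists (undup (map norm s)), (fun la => (count_mem la (map norm s))%:Z); split=> //.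
- exact: undup_uniq.
- apply/allP => la; rewrite mem_undup => /mapP[mu _ ->].
  by rewrite /is_partition sort_sorted //= mem_sort mem_filter eqxx.
transitivity (\sum_(la <- map norm s) elem_part la).
  by rewrite big_map; apply: eq_bigr => la _.
by rewrite -big_undup_iterop_count.
Qed.

Lemma e_positive0 : e_positive 0.
Proof. by apply/e_positiveP; exists [::]; rewrite big_nil. Qed.

Lemma e_positiveD F G : e_positive F -> e_positive G -> e_positive (F + G).
Proof.
move=> /e_positiveP[s ->] /e_positiveP[t ->]; apply/e_positiveP; exists (s ++ t).
by rewrite big_cat.
Qed.

Lemma e_positiveM F G : e_positive F -> e_positive G -> e_positive (F * G).
Proof.
move=> /e_positiveP[s ->] /e_positiveP[t ->]; apply/e_positiveP.
exists [seq la ++ mu | la <- s, mu <- t]; rewrite big_allpairs_dep big_distrl /=.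
apply: eq_bigr => la _; rewrite big_distrr; apply: eq_bigr => mu _ /=.
by rewrite /elem_part big_cat.
Qed.

Lemma e_positive_sum I r (P : pred I) (F : I -> xseries) :
  (forall i, P i -> e_positive (F i)) -> e_positive (\sum_(i <- r | P i) F i).
Proof.
by move=> Fpos; apply: big_ind => //; [apply: e_positive0 | apply: e_positiveD].
Qed.

Lemma e_positive_elem i : e_positive (elem i).
Proof.
by apply/e_positiveP; exists [:: [:: i]]; rewrite big_seq1 /elem_part big_seq1.
Qed.

Lemma e_positive1 : e_positive 1.
Proof. by rewrite -elem0; apply: e_positive_elem. Qed.

Lemma e_positive_nat n : e_positive n%:R.
Proof.
elim: n => [|n IHn]; first exact: e_positive0.
by rewrite -natr1; apply: e_positiveD => //; apply: e_positive1.
Qed.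

(** * Power series in z: positivity and coefficients *)

Lemma coef_zseriesM (F G : zseries) n :
  coef (F * G) n = \sum_(i < n.+1) coef F i * coef G (n - i)%N.
Proof.
transitivity (\sum_(p <- [seq (i, n - i)%N | i <- index_iota 0 n.+1])
                coef F p.1 * coef G p.2); first by rewrite /index_iota subn0.
by rewrite big_map big_mkord.
Qed.

Lemma z_e_positiveD F G : z_e_positive F -> z_e_positive G -> z_e_positive (F + G).
Proof. by move=> Fpos Gpos n; apply: e_positiveD. Qed.

Lemma z_e_positiveM F G : z_e_positive F -> z_e_positive G -> z_e_positive (F * G).
Proof.
move=> Fpos Gpos n; rewrite coef_zseriesM; apply: e_positive_sum => i _.
exact: e_positiveM.
Qed.

Lemma z_e_positive_const c : e_positive c -> z_e_positive (zconst c).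
Proof. by move=> cpos n /=; case: eqP => // _; apply: e_positive0. Qed.

Lemma z_e_positive_var k : z_e_positive (zvar ^+ k).
Proof.
elim: k => [|k IHk]; first exact/z_e_positive_const/e_positive1.
by rewrite exprS; apply: z_e_positiveM => // n; apply: e_positive_nat.
Qed.

Lemma z_e_positive_sum I r (P : pred I) (F : I -> zseries) :
  (forall i, P i -> z_e_positive (F i)) -> z_e_positive (\sum_(i <- r | P i) F i).
Proof.
move=> Fpos; apply: big_ind => //; first by move=> n; apply: e_positive0.
exact: z_e_positiveD.
Qed.

Lemma coef_Mzconst (F : zseries) c n : coef (F * zconst c) n = coef F n * c.
Proof.
rewrite coef_zseriesM big_ord_recr /= subnn eqxx big1 ?add0r // => i _.
by rewrite subn_eq0 leqNgt ltn_ord mulr0.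
Qed.

Lemma coef_MzvarX (F : zseries) k n :
  coef (F * zvar ^+ k) n = if (k <= n)%N then coef F (n - k)%N else 0.
Proof.
elim: k n => [|k IHk] n; first by rewrite mulr1 subn0.
rewrite exprSr mulrA; move: (F * zvar ^+ k) IHk => G IHk.
rewrite coef_zseriesM big_ord_recr /= subnn mulr0 addr0.
case: n => [|n]; first by rewrite big_ord0.
rewrite big_ord_recr /= subSnn mulr1 IHk big1 ?add0r ?ltnS ?subSS // => i _.
by have := ltn_ord i => ?; rewrite (_ : _ == _ = false) ?mulr0 //; lia.
Qed.

Lemma coef_Mzmon (F : zseries) c k n :
  coef (F * (zconst c * zvar ^+ k)) n = if (k <= n)%N then coef F (n - k)%N * c else 0.
Proof. by rewrite mulrA coef_MzvarX coef_Mzconst. Qed.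

Lemma zconstD a b : zconst (a + b) = zconst a + zconst b.
Proof. by apply: fpsP => n /=; case: eqP => //; rewrite addr0. Qed.

Lemma zconst0 : zconst 0 = 0.
Proof. by apply: fpsP => n /=; case: eqP. Qed.

Lemma zconstM a b : zconst (a * b) = zconst a * zconst b.
Proof. by apply: fpsP => n; rewrite coef_Mzconst /=; case: eqP; rewrite ?mul0r. Qed.

Lemma zconst_nat n : zconst n%:R = n%:R.
Proof. by elim: n => [|n IHn]; rewrite ?zconst0 // -!natr1 zconstD IHn. Qed.

Lemma zconst_sum I r (P : pred I) F :
  zconst (\sum_(i <- r | P i) F i) = \sum_(i <- r | P i) zconst (F i).
Proof. exact: (big_morph zconst zconstD zconst0). Qed.

Lemma XP1 : XP 1 = elem 1.
Proof.
have := sum_elem_XP 1; rewrite !big_ord_recl big_ord0 /= subr0 subn0 elem0.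
by rewrite subrr !mul1r !mul0r !addr0.
Qed.

(** This solves [sum_elem_XP] for its term of index 0. The term of index 1 vanishes, and all others
    have nonnegative coefficients once moved across. *)
Lemma XPSS n : XP n.+2 = elem n.+2 +
  \sum_(0 <= i < n.+1) (n.+1 - i)%:R * elem (n.+2 - i) * XP i.
Proof.
rewrite -{1}(sum_elem_XP n.+2) 2!big_ord_recl /= subr0 !mul1r elem0 mul1r subn0.
rewrite subrr !mul0r add0r -addrA -[LHS]addr0; congr (_ + _).
rewrite big_mkord (reindex_inj rev_ord_inj) /= -big_split /= big1 // => i _.
have ltin : (i <= n)%N by rewrite -ltnS.
rewrite /bump /= !add1n (_ : (n.+2 - (n.+1 - i.+1).+2 = i)%N); last by lia.
rewrite (_ : (n.+1 - i.+1).+2 = (n.+2 - i)%N); last by lia.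
rewrite (_ : (n.+2 - i)%N = (n.+1 - i).+1); last by lia.
by rewrite -natr1; ring.
Qed.

Lemma XP2 : XP 2 = 2 * elem 2.
Proof. by rewrite XPSS big_nat1 /= subn0 XP0 mulr1 mul1r mulrDl mul1r. Qed.

Lemma e_positive_XP n : e_positive (XP n).
Proof.
elim/ltn_ind: n => -[|[|n]] IHn; first by rewrite XP0; apply: e_positive1.
  by rewrite XP1; apply: e_positive_elem.
rewrite XPSS; apply: e_positiveD; first exact: e_positive_elem.
rewrite big_mkord; apply: e_positive_sum => i _; apply: e_positiveM.
  by apply: e_positiveM; [apply: e_positive_nat | apply: e_positive_elem].
by apply: IHn; have := ltn_ord i; lia.
Qed.

(** * The generating functions *)

Lemma natSB1_elem i : (i.+1%:R - 1) * elem i.+1 = i%:R * elem i.+1.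
Proof. by rewrite -natr1 addrK. Qed.

(** The coefficient [1 - i] also fits the low degrees: e_0 = 1 gives the constant 1, and degree 1
    contributes nothing. *)
Lemma XPser_Gser2 : XPser * (1 - Gser 2) = Eser.
Proof.
have -> : 1 - Gser 2 = Fps (fun i : degree_fd => (1 - i%:R) * elem i).
  apply: fpsP => -[|[|i]] /=; rewrite ?subr0 ?elem0 ?mulr1 ?subrr ?mul0r //.
  by rewrite sub0r -mulNr opprB.
apply: fpsP => n; rewrite mulrC coef_zseriesM /= -[RHS]sum_elem_XP.
by apply: eq_bigr => i _.
Qed.

(** With the power of z absorbed, the recurrences become identities in [zelem] and [zXP] alone,
    within reach of [ring]. *)
Definition zelem i : zseries := zconst (elem i) * zvar ^+ i.
Definition zXP i : zseries := zconst (XP i) * zvar ^+ i.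

Lemma GserS k : Gser k.+1 = k%:R * zelem k.+1 + Gser k.+2.
Proof.
have zE : k%:R * zelem k.+1 = 1 * (zconst (k%:R * elem k.+1) * zvar ^+ k.+1).
  by rewrite mul1r zconstM zconst_nat mulrA.
apply: fpsP => i; rewrite zE [RHS]/(coef _ i + coef _ i) coef_Mzmon /=.
have [ki|ki|<-] := ltngtP k.+1 i; rewrite ?add0r ?addr0 //=.
  by rewrite subn_eq0 leqNgt ki mul0r; apply/esym/add0r.
by rewrite subnn eqxx mul1r natSB1_elem; apply/esym/addr0.
Qed.

Lemma zXPSS n : zXP n.+2 = zelem n.+2 +
  \sum_(0 <= i < n.+1) (n.+1 - i)%:R * zelem (n.+2 - i) * zXP i.
Proof.
rewrite /zXP XPSS zconstD zconst_sum mulrDl mulr_suml; congr (_ + _).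
apply: eq_big_nat => i /andP[_ lti]; rewrite !zconstM zconst_nat /zelem.
have -> : zvar ^+ n.+2 = zvar ^+ (n.+2 - i) * zvar ^+ i.
  by rewrite -exprD subnK //; lia.
by ring.
Qed.

Lemma zXP0 : zXP 0 = 1.
Proof. by rewrite /zXP XP0 expr0 mulr1. Qed.

Lemma zXP1 : zXP 1 = zelem 1.
Proof. by rewrite /zXP XP1. Qed.

Lemma fserE l : fser l =
  2 + zelem 1 - zXP l.-1 * (1 - zelem 2) - zXP l - zXP l.+1.
Proof. by []. Qed.

(** The cofactor of [XPser] in E + XP G_k. For [k >= 2] it is the finite sum 1 - e_2 z^2 - 2 e_3 z^3
    - ... - (k-2) e_(k-1) z^(k-1). *)
Definition Gtrunc k : zseries := 1 - Gser 2 + Gser k.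

Lemma GtruncS k : Gtrunc k.+2 = Gtrunc k.+1 - k%:R * zelem k.+1.
Proof. by rewrite /Gtrunc [Gser k.+1]GserS; ring. Qed.

Lemma Gtrunc4 : Gtrunc 4 = 1 - zelem 2 - 2 * zelem 3.
Proof. by rewrite (GtruncS 2) (GtruncS 1) /Gtrunc; ring. Qed.

Lemma XPser_Gtrunc k : XPser * Gtrunc k = Eser + XPser * Gser k.
Proof. by rewrite /Gtrunc mulrDr XPser_Gser2. Qed.

(** The difference of consecutive [fser] brings in one new path function, [zXP l.+4], which [zXPSS]
    expands. *)
Lemma fser_Gtrunc l :
  fser l.+2 = \sum_(3 <= i < l.+4) (i - 2)%N%:R * zelem i + 2 * Gtrunc l.+4
    + \sum_(1 <= i < l.+1) Gtrunc (l.+4 - i) * zXP i.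
Proof.
elim: l => [|l IHl].
  rewrite big_nat1 [X in _ + X]big_geq // Gtrunc4 fserE /= !zXPSS.
  rewrite big_nat1 big_nat_recl // big_nat1 /= !zXP0 zXP1 /=.
  by rewrite !subn0 !subSS !subn0; ring.
have -> : fser l.+3 =
    fser l.+2 - zXP l.+4 + zXP l.+1 * (1 - zelem 2) + zelem 2 * zXP l.+2.
  by rewrite !fserE /=; ring.
(* The extreme terms are split off: the one with [zXP l.+2] cancels, the one with [zXP l.+1]
   completes [Gtrunc 4], and the one with [zXP 0] adjusts the coefficient of [zelem l.+4]. *)
have rec := zXPSS l.+2; rewrite big_nat_recl // zXP0 !subn0 big_nat_recr // in rec.
rewrite big_nat_recr //= in rec; rewrite {}rec.
rewrite IHl [in RHS]big_nat_recr //= [X in _ = _ + X]big_nat_recr //=.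
rewrite (GtruncS l.+3).
(* Raising the index of each [Gtrunc] by one subtracts exactly the middle terms of the
   recurrence. *)
have -> : \sum_(1 <= i < l.+1) Gtrunc (l.+4.+1 - i) * zXP i =
   \sum_(1 <= i < l.+1) Gtrunc (l.+4 - i) * zXP i
   - \sum_(0 <= i < l) (l.+3 - i.+1)%:R * zelem (l.+4 - i.+1) * zXP i.+1.
  rewrite big_add1 /= [X in X - _]big_add1 -sumrB; apply: eq_big_nat => i /andP[_ il].
  have -> : (l.+4.+1 - i.+1 = (l.+2 - i).+2)%N by lia.
  have -> : (l.+4 - i.+1 = (l.+2 - i).+1)%N by lia.
  have -> : (l.+3 - i.+1 = l.+2 - i)%N by lia.
  by rewrite GtruncS; ring.
have -> : (l.+4.+1 - l.+1 = 4)%N by lia.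
have -> : (l.+4 - l.+1 = 3)%N by lia.
have -> : (l.+3 - l.+1 = 2)%N by lia.
have -> : (l.+4 - l.+2 = 2)%N by lia.
have -> : (l.+3 - l.+2 = 1)%N by lia.
have -> : (l.+4 - 2 = l.+2)%N by lia.
by rewrite Gtrunc4 !mulrS; ring.
Qed.

(** Multiplying [fser_Gtrunc] by [XPser] turns each [Gtrunc k] into E + XP G_k. *)
Lemma XPser_fser l : (2 <= l)%N ->
  XPser * fser l =
    XPser * (\sum_(3 <= i < l.+2) zconst ((i - 2)%N%:R * elem i) * zvar ^+ i)
    + 2 * (Eser + XPser * Gser l.+2)
    + \sum_(1 <= i < l.-1)
        (Eser + XPser * Gser (l.+2 - i)) * (zconst (XP i) * zvar ^+ i).
Proof.
case: l => [|[|l]] // _; rewrite fser_Gtrunc 2!mulrDr; congr (_ + _ + _).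
- congr (_ * _); apply: eq_bigr => i _.
  by rewrite zconstM zconst_nat mulrA.
- by rewrite -XPser_Gtrunc mulrCA.
rewrite mulr_sumr; apply: eq_bigr => i _.
by rewrite -XPser_Gtrunc mulrA.
Qed.

(** * Positivity of the generating functions *)

Lemma z_e_positive_XPser : z_e_positive XPser.
Proof. exact: e_positive_XP. Qed.

Lemma z_e_positive_Eser : z_e_positive Eser.
Proof. exact: e_positive_elem. Qed.

(** A positive index leaves out degree 0, whose coefficient -e_0 would be negative. *)
Lemma z_e_positive_Gser k : z_e_positive (Gser k.+1).
Proof.
move=> [|n] /=; first exact: e_positive0.
case: ltnP => _; last exact: e_positive0.
rewrite natSB1_elem.
by apply: e_positiveM; [apply: e_positive_nat | apply: e_positive_elem].
Qed.

Lemma z_e_positive_XPser_fser l : (2 <= l)%N -> z_e_positive (XPser * fser l).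
Proof.
move=> l_ge2; rewrite XPser_fser //.
have EG k : z_e_positive (Eser + XPser * Gser k.+1).
  apply: z_e_positiveD z_e_positive_Eser _.
  exact: z_e_positiveM z_e_positive_XPser (@z_e_positive_Gser k).
apply: z_e_positiveD; first apply: z_e_positiveD.
- apply: z_e_positiveM z_e_positive_XPser _; apply: z_e_positive_sum => i _.
  apply: z_e_positiveM (z_e_positive_var i); apply: z_e_positive_const.
  by apply: e_positiveM; [apply: e_positive_nat | apply: e_positive_elem].
- by rewrite mulr2n mulrDl mul1r; apply: z_e_positiveD; apply: EG.
(* The range of [i] is kept in order to see that [l.+2 - i] is positive. *)
rewrite big_seq; apply: z_e_positive_sum => i; rewrite mem_index_iota => il.
apply: z_e_positiveM.
  by rewrite (_ : (l.+2 - i)%N = (l.+1 - i).+1); [apply: EG | lia].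
apply: z_e_positiveM (z_e_positive_var i); apply: z_e_positive_const.
exact: e_positive_XP.
Qed.

(** The degree is n + 1 for n = a + m + 1. Both sides agree term by term after X_(P_1) = e_1 and
    X_(P_2) = 2 e_2. *)
Lemma XPtwin_coef a m : (0 < a)%N -> (0 < m)%N ->
  XPtwin (a + m).+1 a.+1 = 2 * coef (XPser * fser a.+1) (a + m).+2.
Proof.
move=> a_gt0 m_gt0; rewrite XPtwin_formula // fserE.
have -> : XPser * (2 + zelem 1 - zXP a.+1.-1 * (1 - zelem 2) - zXP a.+1 - zXP a.+2) =
    XPser + XPser + XPser * zelem 1 - XPser * zXP a
    + XPser * (zconst (XP a * elem 2) * zvar ^+ a.+2)
    - XPser * zXP a.+1 - XPser * zXP a.+2.
  by rewrite /zXP /zelem zconstM (exprD _ 2 a) /=; ring.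
set n := (a + m).+2.
have cE (P Q : zseries) : coef (P - Q) n = coef P n - coef Q n by [].
have cD (P Q : zseries) : coef (P + Q) n = coef P n + coef Q n by [].
rewrite !cE cD cE !cD !coef_Mzmon /n.
have -> : (1 <= (a + m).+2)%N by [].
have -> : (a <= (a + m).+2)%N by lia.
have -> : (a < (a + m).+2)%N by lia.
have -> : (a.+1 < (a + m).+2)%N by lia.
have -> : ((a + m).+2 - 1 = (a + m).+1)%N by lia.
have -> : ((a + m).+2 - a = m.+2)%N by lia.
have -> : ((a + m).+2 - a.+1 = m.+1)%N by lia.
have -> : ((a + m).+2 - a.+2 = m)%N by lia.
by rewrite XP2 XP1 /=; ring.
Qed.

Lemma z_e_positive_XPtwin_ser l : (2 <= l)%N -> z_e_positive (XPtwin_ser l).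
Proof.
case: l => // l l_ge2 k /=; case: ltnP => lk; last exact: e_positive0.
(* Here n = k - 1; [l] vertices precede the twinned one and k - 2 - l follow it, a positive number
   by [lk]. *)
rewrite (_ : k.-1 = (l + (k.-1 - l.+1)).+1); last by lia.
rewrite XPtwin_coef; [|by lia..].
by apply: e_positiveM; [apply: e_positive_nat | apply: z_e_positive_XPser_fser].
Qed.

Theorem theorem3p24 (l : nat) (hl : (2 <= l)%N) :
  [/\ XPser * fser l =
        XPser * (\sum_(3 <= i < l.+2)
                   zconst ((i - 2)%N%:R * elem i) * zvar ^+ i)
        + 2 * (Eser + XPser * Gser l.+2)
        + \sum_(1 <= i < l.-1)
            (Eser + XPser * Gser (l.+2 - i)) * (zconst (XP i) * zvar ^+ i),
      z_e_positive (XPser * fser l)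
    & z_e_positive (XPtwin_ser l)].
Proof.
by split; [apply: XPser_fser | apply: z_e_positive_XPser_fser
          | apply: z_e_positive_XPtwin_ser].
Qed.
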